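(* Let $\Lambda$ be a closed order in $K^{2\times 2}$. Then there are $r,m\in\mathbb{Z}_{\ge 0}$ such that, with respect to a suitable basis of $K^2$, $$\Lambda=\mathbb{B}_r\left(\begin{pmatrix}0&m\\0&0\end{pmatrix}\right)=\{X\in\mathcal{O}_K^{2\times 2}\mid X_{12}\in\mathfrak{m}_K^{m+r},\ X_{21}\in\mathfrak{m}_K^r,\ X_{11}\equiv X_{22}\bmod\pi^r\}.$$
   Context: $K$ is a (commutative) discretely valued field, not necessarily complete and with arbitrary residue field, with valuation ring $\mathcal{O}_K$, uniformizer $\pi$ and maximal ideal $\mathfrak{m}_K=\pi\mathcal{O}_K\neq\{0\}$. Here $d=2$. A lattice in $K^2$ is a free $\mathcal{O}_K$-submodule of rank $2$; $[L]=\{\pi^nL\mid n\in\mathbb{Z}\}$ is its homothety class; $\mathcal{B}_2^0(K)$ is the set of all homothety classes. An order in $K^{2\times 2}=\mathrm{End}_K(K^2)$ is a free $\mathcal{O}_K$-submodule of rank $4$ that is a subring containing the identity. $\mathrm{End}_{\mathcal{O}_K}(L)=\{X\in K^{2\times 2}\mid XL\subseteq L\}$. For an order $\Lambda$, $Q(\Lambda)=\{[L]\in\mathcal{B}_2^0(K)\mid\Lambda L=L\}$; $\Lambda$ is closed if $\Lambda=\bigcap_{[L]\in Q(\Lambda)}\mathrm{End}_{\mathcal{O}_K}(L)$. Distance: $\mathrm{dist}([L_1],[L_2])$ is the minimal $s$ such that there are $L_1'\in[L_1]$, $L_2'\in[L_2]$ with $\pi^sL_1'\subseteq L_2'\subseteq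 L_1'$. For $M\in\mathbb{Z}^{2\times2}$ with $M_{ii}=0$ and $M_{ij}+M_{jk}\ge M_{ik}$ for all $i,j,k$, and a chosen basis of $K^2$ with respect to which matrices are written, $\Lambda(M)=\{X\mid X_{ij}\in\mathfrak{m}_K^{M_{ij}}\text{ for all } i,j\}$, an order. The bolytrope $\mathrm{B}_r(M)$ is the set of all $[L]\in\mathcal{B}_2^0(K)$ having distance at most $r$ from some element of $Q(\Lambda(M))$, and $\mathbb{B}_r(M):=\bigcap_{[L]\in\mathrm{B}_r(M)}\mathrm{End}_{\mathcal{O}_K}(L)$ is the corresponding bolytrope order. *)

(* Defs.v *)
From HB Require Import structures.
From mathcomp Require Import all_boot all_order all_algebra.
From mathcomp Require Import boolp classical_sets.

Set Implicit Arguments.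
Unset Strict Implicit.
Unset Printing Implicit Defensive.

Import Order.TTheory GRing.Theory Num.Theory.

Local Open Scope classical_set_scope.
Local Open Scope ring_scope.

(* Normalized discrete valuation. The value at 0 (mathematically +oo) is an
   unconstrained integer, so every use below treats 0 separately. *)
Record discrete_valuation (K : fieldType) := DiscreteValuation {
  valuation :> K -> int;
  valuationM : forall x y, x != 0 -> y != 0 ->
    valuation (x * y) = valuation x + valuation y;
  valuationD : forall x y, x != 0 -> y != 0 -> x + y != 0 ->
    Num.min (valuation x) (valuation y) <= valuation (x + y);
  valuation_surj : exists2 x, x != 0 & valuation x = 1 }.

Definition valuation_ring (K : fieldType) (v : discrete_valuation K) : set K :=
  [set x | x = 0 \/ 0 <= v x].

Definition uniformizer (K : fieldType) (v : discrete_valuation K) (pi : K) :=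
  pi != 0 /\ v pi = 1.

(* The fractional ideal m_K^n = pi^n O_K. *)
Definition max_ideal_pow (K : fieldType) (v : discrete_valuation K) (pi : K)
    (n : int) : set K :=
  [set pi ^ n * a | a in valuation_ring v].

Definition free_submodule (K : fieldType) (v : discrete_valuation K)
    (V : lmodType K) (n : nat) (S : set V) : Prop :=
  exists b : 'I_n -> V,
    (forall a : 'I_n -> K, (forall i, valuation_ring v (a i)) ->
       \sum_i a i *: b i = 0 -> forall i, a i = 0) /\
    S = [set \sum_i a i *: b i |
           a in [set a : 'I_n -> K | forall i, valuation_ring v (a i)]].

(* K^2 is the space of column vectors, on which 'M[K]_2 = End_K(K^2) acts
   by left multiplication. *)
Definition lattice (K : fieldType) (v : discrete_valuation K)
    (L : set 'cV[K]_2) : Prop :=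
  free_submodule v 2 L.

Definition order_in_M2 (K : fieldType) (v : discrete_valuation K)
    (A : set 'M[K]_2) : Prop :=
  [/\ free_submodule v 4 A,
      A 1%:M &
      forall X Y, A X -> A Y -> A (X *m Y)].

Definition scale_set (K : fieldType) (c : K) (L : set 'cV[K]_2) :
    set 'cV[K]_2 :=
  [set c *: x | x in L].

Definition homothety_class (K : fieldType) (pi : K) (L : set 'cV[K]_2) :
    set (set 'cV[K]_2) :=
  [set scale_set (pi ^ n) L | n in [set: int]].

Definition building_vertices (K : fieldType) (v : discrete_valuation K)
    (pi : K) : set (set (set 'cV[K]_2)) :=
  [set homothety_class pi L | L in lattice v].

Definition lattice_end (K : fieldType) (L : set 'cV[K]_2) : set 'M[K]_2 :=
  [set X | forall x, L x -> L (X *m x)].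

(* The product A L is the set of finite sums of products. *)
Definition order_act (K : fieldType) (A : set 'M[K]_2) (L : set 'cV[K]_2) :
    set 'cV[K]_2 :=
  [set x | exists n (X : 'I_n -> 'M[K]_2) (y : 'I_n -> 'cV[K]_2),
     (forall i, A (X i) /\ L (y i)) /\ x = \sum_i X i *m y i].

Definition Qset (K : fieldType) (v : discrete_valuation K) (pi : K)
    (A : set 'M[K]_2) : set (set (set 'cV[K]_2)) :=
  [set homothety_class pi L | L in [set L | lattice v L /\ order_act A L = L]].

(* Intersection of End(L) over [L] in C; End(L) depends on [L] only, so all
   representatives L are taken. *)
Definition end_bigcap (K : fieldType) (v : discrete_valuation K) (pi : K)
    (C : set (set (set 'cV[K]_2))) : set 'M[K]_2 :=
  \bigcap_(L in [set L | lattice v L /\ C (homothety_class pi L)])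
    lattice_end L.

Definition closed_order (K : fieldType) (v : discrete_valuation K) (pi : K)
    (A : set 'M[K]_2) : Prop :=
  order_in_M2 v A /\ A = end_bigcap v pi (Qset v pi A).

Definition within_dist (K : fieldType) (pi : K)
    (c1 c2 : set (set 'cV[K]_2)) (s : nat) : Prop :=
  exists L1 L2, [/\ c1 L1, c2 L2,
    scale_set (pi ^+ s) L1 `<=` L2 & L2 `<=` L1].

Definition is_dist (K : fieldType) (pi : K)
    (c1 c2 : set (set 'cV[K]_2)) (s : nat) : Prop :=
  within_dist pi c1 c2 s /\
  forall t, within_dist pi c1 c2 t -> (s <= t)%N.

Definition exponent_matrix (M : 'M[int]_2) : Prop :=
  (forall i, M i i = 0) /\ (forall i j k, M i k <= M i j + M j k).

(* The basis of K^2 consists of the columns of the invertible matrix g; this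
   is the matrix, in that basis, of the endomorphism X. *)
Definition in_basis (K : fieldType) (g X : 'M[K]_2) : 'M[K]_2 :=
  invmx g *m X *m g.

Definition graduated_order (K : fieldType) (v : discrete_valuation K) (pi : K)
    (g : 'M[K]_2) (M : 'M[int]_2) : set 'M[K]_2 :=
  [set X | forall i j, max_ideal_pow v pi (M i j) (in_basis g X i j)].

Definition bolytrope (K : fieldType) (v : discrete_valuation K) (pi : K)
    (g : 'M[K]_2) (r : nat) (M : 'M[int]_2) : set (set (set 'cV[K]_2)) :=
  [set c | building_vertices v pi c /\
     exists c' s, [/\ Qset v pi (graduated_order v pi g M) c',
                      is_dist pi c c' s & (s <= r)%N]].

Definition bolytrope_order (K : fieldType) (v : discrete_valuation K) (pi : K)
    (g : 'M[K]_2) (r : nat) (M : 'M[int]_2) : set 'M[K]_2 :=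
  end_bigcap v pi (bolytrope v pi g r M).

(* The matrix (0 m; 0 0). *)
Definition upper_exponent (m : nat) : 'M[int]_2 :=
  \matrix_(i < 2, j < 2) if (i == 0) && (j == 1) then m%:Z else 0.

Lemma upper_exponentP (m : nat) : exponent_matrix (upper_exponent m).
Proof.
split=> [i|i j k]; rewrite !mxE; first by case: i => [[|[|[]]]].
by case: i j k => [[|[|[]]]] // ? [[|[|[]]]] // ? [[|[|[]]]] // ? /=;
  rewrite ?addr0 ?add0r ?lexx.
Qed.

(* Main.v *)
(* Writing lattices as h O^2, a closed order A is the intersection of the
   h M_2(O) h^-1 that contain it. Choose g and the largest D such that A lies in
   g E g^-1, where E consists of the integral matrices whose upper right entry is
   in m^D; D is bounded, since the commutator of two elements of E has
   determinant in m^D. So A stabilizes the two ends of a path of length D in the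
   tree, and this path is a diameter of the subtree fixed by A. Another fixed
   vertex, leaving the path at distance i from one end and lying at distance s
   from it, satisfies s <= min(i, D - i); then stabilizing it just means
   X11 = X22 mod pi^s for X in g E g^-1. Hence A is cut out in g E g^-1 by
   X11 = X22 mod pi^r for the largest such r <= D/2, and conjugation by
   diag(pi^r, 1) gives the claim with m = D - 2r. The matrices described there
   form O + pi^r Lambda(m), which stabilizes the ball of radius r around any
   Lambda(m)-stable lattice, and three lattices of the bolytrope suffice to
   impose the congruences. *)
Require Import Defs.
From mathcomp Require Import all_boot all_order all_algebra.
From mathcomp Require Import boolp classical_sets.
From mathcomp Require Import zify ring.

Set Implicit Arguments.
Unset Strict Implicit.
Unset Printing Implicit Defensive.

Import Order.TTheory GRing.Theory Num.Theory.

Local Open Scope classical_set_scope.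
Local Open Scope ring_scope.

(** * Two-by-two matrices written out by entries *)

Section Matrices2.
Variable R : comUnitRingType.

Definition mx2 (a b c d : R) : 'M[R]_2 :=
  \matrix_(i < 2, j < 2)
    if i == 0 then (if j == 0 then a else b) else (if j == 0 then c else d).

Lemma ord2P (i : 'I_2) : i = 0 \/ i = 1.
Proof. by case: i => [[|[|[]]]] // ?; [left | right]; apply: val_inj. Qed.

Lemma mx2_eta (X : 'M[R]_2) : X = mx2 (X 0 0) (X 0 1) (X 1 0) (X 1 1).
Proof.
apply/matrixP => i j; rewrite mxE.
by case: (ord2P i) => ->; case: (ord2P j) => ->.
Qed.

Lemma mx2E (a b c d : R) :
  ((mx2 a b c d 0 0 = a) * (mx2 a b c d 0 1 = b) *
   (mx2 a b c d 1 0 = c) * (mx2 a b c d 1 1 = d))%type.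
Proof. by rewrite !mxE. Qed.

Lemma mul_mx2 (a b c d a' b' c' d' : R) :
  mx2 a b c d *m mx2 a' b' c' d' =
  mx2 (a * a' + b * c') (a * b' + b * d') (c * a' + d * c') (c * b' + d * d').
Proof.
apply/matrixP => i j; rewrite !mxE !big_ord_recl big_ord0 !mxE /= addr0.
by case: (ord2P i) => ->; case: (ord2P j) => ->.
Qed.

Lemma sub_mx2 (a b c d a' b' c' d' : R) :
  mx2 a b c d - mx2 a' b' c' d' = mx2 (a - a') (b - b') (c - c') (d - d').
Proof.
apply/matrixP => i j; rewrite !mxE.
by case: (ord2P i) => ->; case: (ord2P j) => ->.
Qed.

Lemma scale_mx2 (e a b c d : R) :
  e *: mx2 a b c d = mx2 (e * a) (e * b) (e * c) (e * d).
Proof.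
apply/matrixP => i j; rewrite !mxE.
by case: (ord2P i) => ->; case: (ord2P j) => ->.
Qed.

Lemma mx2_1 : 1%:M = mx2 1 0 0 1.
Proof.
apply/matrixP => i j; rewrite !mxE.
by case: (ord2P i) => ->; case: (ord2P j) => ->.
Qed.

Lemma det_mx2 (a b c d : R) : \det (mx2 a b c d) = a * d - b * c.
Proof.
rewrite (expand_det_row _ 0) !big_ord_recl big_ord0 /cofactor !det_mx11 !mxE /=.
by rewrite /bump /= expr0 expr1; ring.
Qed.

End Matrices2.

(** * Change of basis as conjugation *)

Section InBasis.
Variable K : fieldType.
Implicit Types (g h k X Y : 'M[K]_2).

Lemma invmx_right g k : g *m k = 1%:M -> invmx g = k.
Proof.
move=> gk; have [gu _] := mulmx1_unit gk.
by rewrite -[k]mul1mx -(mulVmx gu) -mulmxA gk mulmx1.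
Qed.

Lemma invmx_mul g k :
  g \in unitmx -> k \in unitmx -> invmx (g *m k) = invmx k *m invmx g.
Proof.
move=> gu ku; apply: invmx_right.
by rewrite mulmxA -(mulmxA g) mulmxV // mulmx1 mulmxV.
Qed.

Lemma in_basisM g k X : g \in unitmx -> k \in unitmx ->
  in_basis (g *m k) X = in_basis k (in_basis g X).
Proof. by move=> gu ku; rewrite /in_basis invmx_mul // !mulmxA. Qed.

Lemma in_basisZ c g X : c != 0 -> g \in unitmx ->
  in_basis (c *: g) X = in_basis g X.
Proof.
move=> c0 gu; rewrite /in_basis (@invmx_right _ (c^-1 *: invmx g)); last first.
  by rewrite -scalemxAl -scalemxAr scalerA divff // scale1r mulmxV.
by rewrite -!scalemxAl -scalemxAr scalerA mulVf // scale1r.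
Qed.

Lemma in_basis_mul g X Y : g \in unitmx ->
  in_basis g (X *m Y) = in_basis g X *m in_basis g Y.
Proof. by move=> gu; rewrite /in_basis !mulmxA mulmxK. Qed.

Lemma in_basisB g X Y : in_basis g (X - Y) = in_basis g X - in_basis g Y.
Proof. by rewrite /in_basis mulmxBr mulmxBl. Qed.

Lemma in_basis_invK g X : g \in unitmx -> in_basis g (in_basis (invmx g) X) = X.
Proof.
by move=> gu; rewrite /in_basis invmxK !mulmxA mulVmx // mul1mx mulmxKV.
Qed.

Lemma det_in_basis g X : g \in unitmx -> \det (in_basis g X) = \det X.
Proof.
move=> gu; rewrite /in_basis !det_mulmx det_inv mulrC mulrA divff ?mul1r //.
by rewrite -unitfE -unitmxE.
Qed.

Lemma mx2_unit (p q r t : K) : (mx2 p q r t \in unitmx) = (p * t - q * r != 0).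
Proof. by rewrite unitmxE det_mx2 unitfE. Qed.

Lemma in_basis_mx2 (p q r t a b c d : K) : p * t - q * r != 0 ->
  let D := p * t - q * r in
  in_basis (mx2 p q r t) (mx2 a b c d) =
  mx2 ((t * (a * p + b * r) - q * (c * p + d * r)) / D)
      ((t * (a * q + b * t) - q * (c * q + d * t)) / D)
      ((p * (c * p + d * r) - r * (a * p + b * r)) / D)
      ((p * (c * q + d * t) - r * (a * q + b * t)) / D).
Proof.
move=> D0 D; rewrite /in_basis.
rewrite (@invmx_right _ (mx2 (t / D) (- q / D) (- r / D) (p / D))).
  by rewrite !mul_mx2; congr mx2; rewrite /D; field.
by rewrite mul_mx2 mx2_1; congr mx2; rewrite /D; field.
Qed.

End InBasis.

(** * Fractional ideals described by the valuation *)

Section Valuation.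
Variables (K : fieldType) (v : discrete_valuation K).

(** This is [m_K^n], read off the valuation instead of a uniformizer; [max_ideal_powE] identifies
    the two. At [n = 0] it is convertible to [valuation_ring v]. *)
Definition frac_ideal (n : int) : set K := [set x | x = 0 \/ n <= v x].

Lemma frac_ideal0 n : frac_ideal n 0. Proof. by left. Qed.

Lemma frac_idealD n x y :
  frac_ideal n x -> frac_ideal n y -> frac_ideal n (x + y).
Proof.
case=> [-> |vx]; first by rewrite add0r.
case=> [-> |vy]; first by rewrite addr0; right.
have [->|x0] := eqVneq x 0; first by rewrite add0r; right.
have [->|y0] := eqVneq y 0; first by rewrite addr0; right.
have [->|xy0] := eqVneq (x + y) 0; first exact: frac_ideal0.
by right; apply: le_trans (valuationD v x0 y0 xy0); rewrite le_min vx vy.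
Qed.

Lemma frac_idealM n k x y :
  frac_ideal n x -> frac_ideal k y -> frac_ideal (n + k) (x * y).
Proof.
case=> [-> |vx]; first by rewrite mul0r; left.
case=> [-> |vy]; first by rewrite mulr0; left.
have [->|x0] := eqVneq x 0; first by rewrite mul0r; left.
have [->|y0] := eqVneq y 0; first by rewrite mulr0; left.
by right; rewrite valuationM // lerD.
Qed.

Lemma valuation1 : v 1 = 0.
Proof.
by apply: (addrI (v 1)); rewrite -valuationM ?oner_neq0 // mulr1 addr0.
Qed.

Lemma valuationN1 : v (- 1) = 0.
Proof.
have n0 : - 1 != 0 :> K by rewrite oppr_eq0 oner_neq0.
by have := valuationM v n0 n0; rewrite mulrNN mulr1 valuation1; lia.
Qed.

Lemma valuationV x : x != 0 -> v x^-1 = - v x.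
Proof.
move=> x0; have := valuationM v x0 (invr_neq0 x0).
by rewrite divff // valuation1; lia.
Qed.

Lemma frac_ideal1 : frac_ideal 0 1.
Proof. by right; rewrite valuation1. Qed.

Lemma frac_idealMl n x y : frac_ideal 0 x -> frac_ideal n y -> frac_ideal n (x * y).
Proof. by rewrite -{2}[n]add0r; apply: frac_idealM. Qed.

Lemma frac_idealN n x : frac_ideal n x -> frac_ideal n (- x).
Proof.
by rewrite -mulN1r; apply: frac_idealMl; right; rewrite valuationN1.
Qed.

Lemma frac_idealB n x y :
  frac_ideal n x -> frac_ideal n y -> frac_ideal n (x - y).
Proof. by move=> ? ?; apply/frac_idealD/frac_idealN. Qed.

Lemma frac_ideal_le n k x : k <= n -> frac_ideal n x -> frac_ideal k x.
Proof. by move=> kn [->|vx]; [left | right; apply: le_trans vx]. Qed.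

Lemma frac_ideal_sum n I (r : seq I) (P : pred I) (F : I -> K) :
  (forall i, P i -> frac_ideal n (F i)) ->
  frac_ideal n (\sum_(i <- r | P i) F i).
Proof.
by move=> H; apply: big_ind => //; [exact: frac_ideal0 | exact: frac_idealD].
Qed.

Variables (pi : K) (hpi : uniformizer v pi).

Lemma unif_neq0 : pi != 0. Proof. by case: hpi. Qed.

Lemma unif_exp_neq0 (n : int) : pi ^ n != 0.
Proof. exact/expfz_neq0/unif_neq0. Qed.

Lemma unif_expD (n k : int) : pi ^ (n + k) = pi ^ n * pi ^ k.
Proof. exact/expfzDr/unif_neq0. Qed.

Lemma unif_expN (n : int) : pi ^ (- n) = (pi ^ n)^-1.
Proof. by rewrite invr_expz. Qed.

Lemma valuation_unif_exp (n : int) : v (pi ^ n) = n.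
Proof.
have nat_case (k : nat) : v (pi ^ k%:Z) = k%:Z.
  elim: k => [|k IHk]; first by rewrite expr0z valuation1.
  rewrite -addn1 PoszD unif_expD valuationM ?unif_exp_neq0 // IHk expr1z.
  by case: hpi => _ ->.
case: (intP n) => [|k|k]; first exact: (nat_case 0%N).
  exact: nat_case.
by rewrite unif_expN valuationV ?unif_exp_neq0 // nat_case.
Qed.

Lemma frac_ideal_exp (n : int) : frac_ideal n (pi ^ n).
Proof. by right; rewrite valuation_unif_exp. Qed.

Lemma frac_ideal_expM (k n : int) x :
  frac_ideal n (pi ^ k * x) <-> frac_ideal (n - k) x.
Proof.
split=> H; last first.
  by rewrite -[n](subrK k) addrC; apply: frac_idealM => //; apply: frac_ideal_exp.
have -> : x = pi ^ (- k) * (pi ^ k * x).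
  by rewrite mulrA -unif_expD addNr expr0z mul1r.
by rewrite addrC; apply: frac_idealM => //; apply: frac_ideal_exp.
Qed.

Lemma max_ideal_powE (n : int) : max_ideal_pow v pi n = frac_ideal n.
Proof.
apply/seteqP; split=> x /=.
  move=> [a Oa <-]; apply/frac_ideal_expM; rewrite subrr.
  exact: Oa.
move=> nx; exists (pi ^ (- n) * x).
  by apply/(frac_ideal_expM (- n) 0); rewrite sub0r opprK.
by rewrite mulrA -unif_expD subrr expr0z mul1r.
Qed.

Lemma common_denominator n (a : 'I_n -> K) :
  exists N : nat, forall i, frac_ideal 0 (pi ^ N%:Z * a i).
Proof.
(* The sum dominates each [- v (a i)]. An entry 0 needs no separate case, its value being some
   integer as well. *)
exists (\sum_i `|v (a i)|)%N => i; apply/frac_ideal_expM; right.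
by rewrite (bigD1 i) //=; lia.
Qed.

End Valuation.

(** * Lattices in [K^2] and the stabilizers of their classes *)

Section Stabilizers.
Variables (K : fieldType) (v : discrete_valuation K) (pi : K).
Hypothesis hpi : uniformizer v pi.
Implicit Types (g h k X Y : 'M[K]_2) (L : set 'cV[K]_2).

Let pi0 (n : int) : pi ^ n != 0. Proof. exact: (unif_exp_neq0 hpi). Qed.

Definition integral_mx (m n : nat) (Y : 'M[K]_(m, n)) : Prop :=
  forall i j, frac_ideal v 0 (Y i j).

Lemma integral_mxM (m n p : nat) (X : 'M[K]_(m, n)) (Y : 'M[K]_(n, p)) :
  integral_mx X -> integral_mx Y -> integral_mx (X *m Y).
Proof.
move=> OX OY i j; rewrite mxE.
by apply: frac_ideal_sum => l _; apply: frac_idealMl.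
Qed.

Lemma integral_mxZ (m n : nat) c (Y : 'M[K]_(m, n)) :
  frac_ideal v 0 c -> integral_mx Y -> integral_mx (c *: Y).
Proof. by move=> Oc OY i j; rewrite mxE; apply: frac_idealMl. Qed.

Lemma integral_mx2 (a b c d : K) :
  integral_mx (mx2 a b c d) <->
  [/\ frac_ideal v 0 a, frac_ideal v 0 b, frac_ideal v 0 c & frac_ideal v 0 d].
Proof.
split=> [H|[Oa Ob Oc Od] i j].
  by split; [move: (H 0 0) | move: (H 0 1) | move: (H 1 0) | move: (H 1 1)];
    rewrite mxE.
by rewrite mxE; case: (ord2P i) => ->; case: (ord2P j) => ->.
Qed.

Definition lat h : set 'cV[K]_2 := [set h *m x | x in @integral_mx 2 1].

(** The maximal order [h M_2(O) h^-1]. For invertible [h] it is the endomorphism ring of [lat h], so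
    it stands for a vertex of the tree. *)
Definition stab h X : Prop := integral_mx (in_basis h X).

Lemma latP h x : h \in unitmx -> lat h x <-> integral_mx (invmx h *m x).
Proof.
move=> hu; split=> [[y Oy <-]|O]; first by rewrite mulKmx.
by exists (invmx h *m x); rewrite ?mulKVmx.
Qed.

Lemma latD h x y : lat h x -> lat h y -> lat h (x + y).
Proof.
move=> [a Oa <-] [b Ob <-]; exists (a + b); rewrite ?mulmxDr //.
by move=> i j; rewrite mxE; apply: frac_idealD.
Qed.

Lemma latZ h c x : frac_ideal v 0 c -> lat h x -> lat h (c *: x).
Proof.
move=> Oc [a Oa <-]; exists (c *: a); rewrite ?scalemxAr //.
exact: integral_mxZ.
Qed.

Lemma lattice_end_lat h X : h \in unitmx -> lattice_end (lat h) X <-> stab h X.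
Proof.
move=> hu; split=> [H i j|H x /(latP _ hu) Ox].
  have /(latP _ hu): lat h (X *m (h *m delta_mx j 0)).
    apply/H; exists (delta_mx j 0) => // i' j'; rewrite mxE.
    by case: (_ && _); [apply: frac_ideal1 | apply: frac_ideal0].
  by rewrite !mulmxA -colE => /(_ i 0); rewrite mxE.
apply/(latP _ hu).
have -> : invmx h *m (X *m x) = in_basis h X *m (invmx h *m x).
  by rewrite /in_basis !mulmxA mulmxK.
exact: integral_mxM.
Qed.

Lemma lattice_lat h : h \in unitmx -> lattice v (lat h).
Proof.
move=> hu; have sumE (a : 'I_2 -> K) :
    \sum_i a i *: col i h = h *m (\col_i a i).
  apply/matrixP => i j; rewrite summxE mxE; apply: eq_bigr => l _.
  by rewrite !mxE mulrC.
exists (fun i => col i h); split=> [a _|].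
  rewrite sumE => /(congr1 (mulmx (invmx h))); rewrite mulKmx // mulmx0.
  by move=> /matrixP a0 i; have := a0 i 0; rewrite !mxE.
apply/seteqP; split=> x /=.
  move=> [y Oy <-]; exists (fun i => y i 0) => /=; first by move=> i; apply: Oy.
  rewrite sumE; congr (h *m _).
  by apply/matrixP => i j; rewrite mxE (ord1 j).
move=> [a Oa <-]; exists (\col_i a i); last by rewrite sumE.
by move=> i j; rewrite mxE; apply: Oa.
Qed.

(** A relation over [K] becomes one over the valuation ring after multiplication by a power of
    [pi]. *)
Lemma integral_free_over_field (V : lmodType K) (n : nat) (b : 'I_n -> V) :
  (forall a : 'I_n -> K, (forall i, valuation_ring v (a i)) ->
     \sum_i a i *: b i = 0 -> forall i, a i = 0) ->
  forall a : 'I_n -> K, \sum_i a i *: b i = 0 -> forall i, a i = 0.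
Proof.
move=> Hb a a0 i; have [N ON] := common_denominator hpi a.
have /eqP : pi ^ N%:Z * a i = 0.
  apply: (Hb (fun i => pi ^ N%:Z * a i)) => //.
  transitivity (pi ^ N%:Z *: \sum_i a i *: b i); last by rewrite a0 scaler0.
  by rewrite scaler_sumr; apply: eq_bigr => j _; rewrite scalerA.
by rewrite mulf_eq0 (negbTE (pi0 _)) => /eqP.
Qed.

Lemma lattice_is_lat L : lattice v L -> exists2 h, h \in unitmx & L = lat h.
Proof.
move=> [b [/integral_free_over_field bfree ->]].
pose h := \matrix_(i < 2, j < 2) b j i 0.
have sumE (a : 'I_2 -> K) : \sum_i a i *: b i = h *m (\col_i a i).
  apply/matrixP => i j; rewrite summxE mxE; apply: eq_bigr => l _.
  by rewrite !mxE mulrC (ord1 j).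
exists h.
  (* [det0P] gives a left kernel vector, hence the transpose; its entries form a relation over [K]
     between the basis vectors. *)
  rewrite -unitmx_tr unitmxE unitfE; apply/det0P => -[w w0 wh].
  case/negP: w0; apply/eqP/matrixP => i j; rewrite (ord1 i) mxE.
  apply: (bfree (fun j => w 0 j)); rewrite sumE.
  have -> : \col_i w 0 i = w^T by apply/matrixP => k l; rewrite !mxE (ord1 l).
  by apply: trmx_inj; rewrite trmx_mul trmxK wh trmx0.
apply/seteqP; split=> x /=.
  move=> [a Oa <-]; exists (\col_i a i); last by rewrite sumE.
  by move=> i j; rewrite mxE; apply: Oa.
move=> [y Oy <-]; exists (fun i => y i 0) => /=; first by move=> i; apply: Oy.
rewrite sumE; congr (h *m _).
by apply/matrixP => i j; rewrite mxE (ord1 j).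
Qed.

Lemma scale_setE c x L : c != 0 -> scale_set c L x <-> L (c^-1 *: x).
Proof.
move=> c0; split=> [[y Ly <-]|Lx]; first by rewrite scalerA mulVf // scale1r.
by exists (c^-1 *: x) => //; rewrite scalerA divff // scale1r.
Qed.

Lemma lattice_end_scale c L X : c != 0 ->
  lattice_end (scale_set c L) X <-> lattice_end L X.
Proof.
move=> c0; split=> H x; last first.
  by rewrite !scale_setE // scalemxAr; apply: H.
move=> Lx; have := H (c *: x).
rewrite !scale_setE // scalemxAr !scalerA mulVf // !scale1r; exact.
Qed.

Lemma homothety_class_refl L : homothety_class pi L L.
Proof.
exists 0 => //; apply/seteqP; split=> x.
  by rewrite expr0z scale_setE ?oner_neq0 // invr1 scale1r.
by rewrite expr0z scale_setE ?oner_neq0 // invr1 scale1r.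
Qed.

(** For [[L]] in [Q(A)], [A L = L] puts [A] inside [End(L)], so [End(L)] is one of the [stab h] that
    contain [A]. This is how closedness enters the classification. *)
Lemma closed_order_stab (A : set 'M[K]_2) X : closed_order v pi A ->
  (forall h, h \in unitmx -> (forall Y, A Y -> stab h Y) -> stab h X) -> A X.
Proof.
move=> [_ AE] HX; rewrite AE => L [_ [L' [latL' actL'] LL']].
(* [L] and [L'] have the same class; as [L] lies in its own class, it is a power of [pi] times
   [L']. *)
move: (homothety_class_refl L); rewrite -LL' => -[n _ <-].
apply/lattice_end_scale => //.
have [h hu L'h] := lattice_is_lat latL'.
rewrite L'h; apply/lattice_end_lat => //; apply: HX => // Y AY.
apply/lattice_end_lat => //; rewrite -L'h => x Lx.
rewrite -{}actL'; exists 1%N, (fun=> Y), (fun=> x); split => //.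
by rewrite big_ord1.
Qed.

(** * Free submodules of rank four in the matrix algebra *)

(** By dimension, a basis of [A] over the valuation ring is a basis of the matrix algebra over [K];
    [pi ^ N] clears the denominators of the coordinates of [X]. *)
Lemma free_submodule4_span (A : set 'M[K]_2) X :
  free_submodule v 4 A -> exists N : nat, A (pi ^ N%:Z *: X).
Proof.
move=> [b [/integral_free_over_field bfree ->]].
pose B := [tuple b i | i < 4].
have BE (a : 'I_4 -> K) : \sum_i a i *: B`_i = \sum_i a i *: b i.
  by apply: eq_bigr => i _; rewrite -tnth_nth tnth_mktuple.
have Bfree : free B by apply/freeP => a; rewrite BE; apply: bfree.
have XB : X \in <<B>>%VS.
  suff /eqP-> : (<<B>> == fullv)%VS by rewrite memvf.
  rewrite -(dimv_leqif_eq (subvf _)) (eqP Bfree) size_tuple dimvf dim_matrix.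
  by [].
have [N ON] := common_denominator hpi (fun i => coord B i X).
exists N, (fun i => pi ^ N%:Z * coord B i X) => //.
rewrite [in RHS](coord_span XB) BE scaler_sumr.
by apply: eq_bigr => i _; rewrite scalerA.
Qed.

(** Otherwise [A] contains [pi^-1 *: b 0], and comparing coefficients of [b 0] makes [pi] invertible
    in the valuation ring. This serves to show that a closed order stabilizes some vertex. *)
Lemma free_submodule4_proper (A : set 'M[K]_2) :
  free_submodule v 4 A -> exists X, ~ A X.
Proof.
move=> [b [bfree AE]]; apply/existsNP => AT.
have := AT (pi^-1 *: b 0); rewrite {1}AE => -[a Oa aE].
have Opia i : valuation_ring v (pi * a i - (i == 0)%:R).
  apply: frac_idealB; last first.
    by case: (i == 0); [apply: frac_ideal1 | apply: frac_ideal0].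
  by apply: frac_idealMl; [right; case: hpi => _ -> | apply: Oa].
have sum0 : \sum_i (pi * a i - (i == 0)%:R) *: b i = 0.
  under eq_bigr do rewrite scalerBl -scalerA.
  rewrite sumrB -scaler_sumr aE scalerA divff ?(unif_neq0 hpi) // scale1r.
  rewrite (bigD1 0) //= scale1r big1 ?addr0 ?subrr // => i /negbTE->.
  by rewrite scale0r.
have /eqP := bfree _ Opia sum0 0; rewrite subr_eq0 eqxx => /eqP pia.
have [/eqP|] : frac_ideal v 1 (1 : K).
  rewrite -[X in frac_ideal v 1 X]pia -[X in X * _]expr1z.
  by apply/(frac_ideal_expM hpi); rewrite subrr; apply: Oa.
  by rewrite oner_eq0.
by rewrite valuation1.
Qed.

(** Multiples of the matrix units [E_12] and [E_21] by powers of [pi] lie in [A], and their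
    commutator is a nonzero multiple of [diag(1, -1)]. *)
Lemma free_submodule4_commutator (A : set 'M[K]_2) : free_submodule v 4 A ->
  exists X Y, [/\ A X, A Y & \det (X *m Y - Y *m X) != 0].
Proof.
move=> Afree; have [N AX] := free_submodule4_span (mx2 0 1 0 0) Afree.
have [M AY] := free_submodule4_span (mx2 0 0 1 0) Afree.
exists (pi ^ N%:Z *: mx2 0 1 0 0), (pi ^ M%:Z *: mx2 0 0 1 0); split=> //.
rewrite !scale_mx2 !mul_mx2 sub_mx2 det_mx2.
rewrite !(mulr0, mul0r, mulr1, addr0, add0r, subr0, sub0r, mulrN, oppr_eq0).
by rewrite oppr0 subr0 oppr_eq0 !mulf_eq0 !negb_or !pi0.
Qed.

(** * Eichler orders of level [m_K^D], the stabilizers of paths of length [D] *)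

Definition eichler g (D : nat) X : Prop :=
  stab g X /\ frac_ideal v D%:Z (in_basis g X 0 1).

(* As determinants are invariant under conjugation, this bounds [D]
   independently of [g]. *)
Lemma eichler_commutator g (D : nat) X Y : g \in unitmx ->
  eichler g D X -> eichler g D Y ->
  frac_ideal v D%:Z (\det (X *m Y - Y *m X)).
Proof.
move=> gu [OX X01] [OY Y01].
rewrite -(det_in_basis _ gu) in_basisB !in_basis_mul //.
have sx := OX; have sy := OY.
rewrite /stab (mx2_eta (in_basis g X)) in sx.
rewrite /stab (mx2_eta (in_basis g Y)) in sy.
move: sx sy => /integral_mx2 [X00 X01' X10 X11] /integral_mx2 [Y00 Y01' Y10 Y11].
rewrite (mx2_eta (in_basis g X)) (mx2_eta (in_basis g Y)) !mul_mx2 sub_mx2.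
rewrite det_mx2.
have fMr x y : frac_ideal v D%:Z x -> frac_ideal v 0 y -> frac_ideal v D%:Z (x * y).
  by move=> Dx Oy; rewrite mulrC; apply: frac_idealMl.
set a := in_basis g X 0 0 in X00 *; set d := in_basis g X 1 1 in X11 *.
set b := in_basis g X 0 1 in X01 X01' *; set c := in_basis g X 1 0 in X10 *.
set a' := in_basis g Y 0 0 in Y00 *; set d' := in_basis g Y 1 1 in Y11 *.
set b' := in_basis g Y 0 1 in Y01 Y01' *; set c' := in_basis g Y 1 0 in Y10 *.
apply: frac_idealB; last first.
  apply: (fMr); first by apply: frac_idealB; apply: frac_idealD;
    by [apply: frac_idealMl | apply: (fMr)].
  by apply: frac_idealB; apply: frac_idealD; apply: frac_idealMl.
(* The products of diagonal entries cancel, and each remaining term has a factor from an upper right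
   corner. *)
have -> : a * a' + b * c' - (a' * a + b' * c) = b * c' - b' * c by ring.
apply: (fMr); first by apply: frac_idealB; apply: (fMr).
by apply: frac_idealB; apply: frac_idealD; apply: frac_idealMl.
Qed.

(** * Normal forms for vertices *)

(** As [k] is invertible over the valuation ring, [h *m k] and [h] span the same lattice, and the
    scalar [c] stays within the homothety class. *)
Lemma stab_mulr c h k k' X : c != 0 -> h \in unitmx -> k *m k' = 1%:M ->
  integral_mx k -> integral_mx k' -> stab (c *: (h *m k)) X <-> stab h X.
Proof.
move=> c0 hu kk' Ok Ok'; have [ku _] := mulmx1_unit kk'.
rewrite /stab in_basisZ ?unitmx_mul ?hu // in_basisM //.
have ik : invmx k = k' by apply: invmx_right.
split=> OX; last by rewrite /in_basis ik; do 2![apply: integral_mxM => //].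
have -> : in_basis h X = k *m in_basis k (in_basis h X) *m k'.
  by rewrite /in_basis -ik !mulmxA mulmxV // mul1mx mulmxK.
by do 2![apply: integral_mxM => //].
Qed.

(* The vertex at distance [s] from the vertex [<pi^i e1, e2>] of the standard
   apartment, in the direction of [u pi^i e1 + e2]; the columns span the same
   lattice as [u pi^i e1 + e2] and [pi^s <pi^i e1, e2>]. *)
Definition normal_mx (i : int) (s : nat) (u : K) : 'M[K]_2 :=
  mx2 (pi ^ (i + s%:Z)) (u * pi ^ i) 0 1.

Definition unit_elt (u : K) : Prop := u != 0 /\ v u = 0.

Lemma unit_eltV u : unit_elt u -> unit_elt u^-1.
Proof.
by case=> u0 vu; split; rewrite ?invr_neq0 // (valuationV _ u0) vu oppr0.
Qed.

Lemma unit_elt_integral u : unit_elt u -> frac_ideal v 0 u.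
Proof. by case=> _ vu; right; rewrite vu. Qed.

Lemma unit_elt_div x : x != 0 -> unit_elt (x / pi ^ v x).
Proof.
move=> x0; split; first by rewrite mulf_neq0 ?invr_neq0.
rewrite valuationM ?invr_neq0 // valuationV // (valuation_unif_exp hpi).
by rewrite subrr.
Qed.

Lemma normal_mx_unit i s u : normal_mx i s u \in unitmx.
Proof. by rewrite mx2_unit mulr1 mulr0 subr0. Qed.

Lemma stab_normal_upper (P Q : K) : P != 0 ->
  exists i s u, unit_elt u /\
    forall X, stab (mx2 P Q 0 1) X <-> stab (normal_mx i s u) X.
Proof.
move=> P0; have hu : mx2 P Q 0 1 \in unitmx by rewrite mx2_unit mulr1 mulr0 subr0.
have O1 := frac_ideal1 v; have O0 := frac_ideal0 v 0.
have w1 := unit_elt_div P0; have w2 := unit_eltV w1.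
case: w1 => w0 vw; have wO : frac_ideal v 0 (P / pi ^ v P) by right; rewrite vw.
have w'O := unit_elt_integral w2.
have [[Q0 vQ]|OQ] : (Q != 0 /\ v Q < v P) \/ frac_ideal v 0 (Q / P).
- have [->|Q0] := eqVneq Q 0; first by right; left; rewrite mul0r.
  have [?|?] := ltP (v Q) (v P); first by left.
  by right; right; rewrite valuationM ?invr_neq0 // valuationV // subr_ge0.
(* The vertex leaves the standard apartment at height [v Q], in the direction of the unit part of
   [Q]; only the unit part [w] of [P] has to be scaled away. *)
- exists (v Q), `|v P - v Q|%N, (Q / pi ^ v Q).
  split=> [|X]; first exact: unit_elt_div.
  set w := P / pi ^ v P in w0 vw w2 wO w'O.
  rewrite -(@stab_mulr 1 _ (mx2 w^-1 0 0 1) (mx2 w 0 0 1)) ?oner_neq0 //.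
  + rewrite mul_mx2 scale1r /normal_mx divfK //.
    have -> : v Q + `|v P - v Q|%N%:Z = v P by lia.
    have -> : pi ^ v P = P * w^-1 by rewrite /w; field; rewrite P0 pi0.
    by rewrite !(mulr0, mul0r, mulr1, mul1r, addr0, add0r).
  + by rewrite mul_mx2 mx2_1; congr mx2; field.
  + exact/integral_mx2.
  + exact/integral_mx2.
(* Here the first column clears [Q], so the vertex lies on the apartment, and with [s = 0] any unit
   serves as [u]. *)
- exists (v P), 0%N, 1; split=> [|X].
    by split; rewrite ?oner_neq0 ?valuation1.
  set w := P / pi ^ v P in w0 vw w2 wO w'O.
  rewrite -(@stab_mulr 1 _ (mx2 w^-1 (w^-1 - Q / P) 0 1)
                            (mx2 w (w * (Q / P) - 1) 0 1)) ?oner_neq0 //.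
  + rewrite mul_mx2 scale1r.
    have wP : P * w^-1 = pi ^ v P by rewrite /w; field; rewrite P0 pi0.
    rewrite /normal_mx addr0 mul1r mulrBr wP !mulr0 !mulr1 !mul0r !addr0 add0r.
    by rewrite mul1r [P * (Q / P)]mulrC divfK // subrK.
  + by rewrite mul_mx2 mx2_1; congr mx2; field; rewrite ?w0 ?P0.
  + by apply/integral_mx2; split => //; apply: frac_idealB.
  + by apply/integral_mx2; split => //; apply: frac_idealB => //; apply: frac_idealMl.
Qed.
(** Column reduction of the bottom row: after a swap if necessary, the right entry [t] divides the
    left one and clears it, and the homothety [t^-1] turns [t] into 1. *)
Lemma stab_upper_triangular h : h \in unitmx ->
  exists P Q, P != 0 /\ forall X, stab h X <-> stab (mx2 P Q 0 1) X.
Proof.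
move=> hu; have O1 := frac_ideal1 v; have O0 := frac_ideal0 v 0.
have ON1 := frac_idealN O1.
suff red p q r t : mx2 p q r t \in unitmx -> t != 0 -> frac_ideal v 0 (r / t) ->
    exists P Q, P != 0 /\
      forall X, stab (mx2 p q r t) X <-> stab (mx2 P Q 0 1) X.
  move: hu; rewrite (mx2_eta h).
  set p := h 0 0; set q := h 0 1; set r := h 1 0; set t := h 1 1 => hu.
  have [[t0 Ort]|[r0 Otr]] : (t != 0 /\ frac_ideal v 0 (r / t)) \/
                             (r != 0 /\ frac_ideal v 0 (t / r)).
  - have [t0|t0] := eqVneq t 0.
      right; rewrite t0 mul0r; split => //.
      by move: hu; rewrite mx2_unit t0 mulr0 sub0r oppr_eq0 mulf_eq0 negb_or => /andP[].
    have [->|r0] := eqVneq r 0; first by left; rewrite mul0r.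
    have [vrt|/ltW vrt] := leP (v t) (v r).
      by left; split=> //; right; rewrite valuationM ?invr_neq0 // valuationV // subr_ge0.
    by right; split=> //; right; rewrite valuationM ?invr_neq0 // valuationV // subr_ge0.
  - exact: red.
  - have hk : 1 *: (mx2 p q r t *m mx2 0 1 1 0) = mx2 q p t r.
      by rewrite scale1r mul_mx2; congr mx2; ring.
    have kk : mx2 0 1 1 0 *m mx2 0 1 1 0 = 1%:M :> 'M[K]_2.
      by rewrite mul_mx2 mx2_1; congr mx2; ring.
    have ku := (mulmx1_unit kk).1.
    have [|//|//|P [Q [P0 H]]] := @red q p t r.
      by rewrite -hk scale1r unitmx_mul hu.
    exists P, Q; split=> // X; rewrite -H -hk stab_mulr ?oner_neq0 //.
    - exact: kk.
    - exact/integral_mx2.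
    - exact/integral_mx2.
move=> hu' t0 Ort; exists ((p * t - q * r) / t / t), (q / t); split=> [|X].
  by rewrite !mulf_neq0 ?invr_neq0 // -mx2_unit.
rewrite -(@stab_mulr t^-1 _ (mx2 1 0 (- (r / t)) 1) (mx2 1 0 (r / t) 1)) ?invr_neq0 //.
- rewrite mul_mx2 scale_mx2.
  suff -> : mx2 (t^-1 * (p * 1 + q * - (r / t))) (t^-1 * (p * 0 + q * 1))
     (t^-1 * (r * 1 + t * - (r / t))) (t^-1 * (r * 0 + t * 1)) =
     mx2 ((p * t - q * r) / t / t) (q / t) 0 1 by [].
  by congr mx2; field.
- by rewrite mul_mx2 mx2_1; congr mx2; ring.
- by apply/integral_mx2; split => //; apply: frac_idealN.
- exact/integral_mx2.
Qed.

Lemma stab_normal_form h : h \in unitmx ->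
  exists i s u, unit_elt u /\ forall X, stab h X <-> stab (normal_mx i s u) X.
Proof.
move=> /stab_upper_triangular [P [Q [P0 hE]]].
have [i [s [u [uu nE]]]] := stab_normal_upper Q P0.
by exists i, s, u; split=> // X; rewrite hE nE.
Qed.

Lemma stab_normal_mx i s u (a b c d : K) :
  stab (normal_mx i s u) (mx2 a b c d) <->
  [/\ frac_ideal v 0 (a - u * pi ^ i * c),
      frac_ideal v (i + s%:Z) (u * pi ^ i * (a - d) + b - (u * pi ^ i) ^+ 2 * c),
      frac_ideal v (- (i + s%:Z)) c & frac_ideal v 0 (c * (u * pi ^ i) + d)].
Proof.
have x0 := pi0 (i + s%:Z).
rewrite /stab /normal_mx in_basis_mx2 ?mulr1 ?mulr0 ?subr0 // integral_mx2.
rewrite !mul0r !addr0 !subr0 !mul1r.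
have -> : (a * pi ^ (i + s%:Z) - u * pi ^ i * (c * pi ^ (i + s%:Z))) /
   pi ^ (i + s%:Z) = a - u * pi ^ i * c by field.
have -> : (a * (u * pi ^ i) + b - u * pi ^ i * (c * (u * pi ^ i) + d)) /
   pi ^ (i + s%:Z) =
   pi ^ (- (i + s%:Z)) * (u * pi ^ i * (a - d) + b - (u * pi ^ i) ^+ 2 * c).
  by rewrite unif_expN //; field.
rewrite (propext (frac_ideal_expM hpi _ _ _)) sub0r opprK.
have -> : pi ^ (i + s%:Z) * (c * pi ^ (i + s%:Z)) / pi ^ (i + s%:Z) =
  pi ^ (i + s%:Z) * c by field.
rewrite (propext (frac_ideal_expM hpi _ _ c)) sub0r.
by have -> : pi ^ (i + s%:Z) * (c * (u * pi ^ i) + d) / pi ^ (i + s%:Z) =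
  c * (u * pi ^ i) + d by field.
Qed.

(** * Vertices as conditions on the elements of an Eichler order *)

Lemma eichlerP g (D : nat) X (Y := in_basis g X) :
  eichler g D X <->
  [/\ frac_ideal v 0 (Y 0 0), frac_ideal v D%:Z (Y 0 1),
      frac_ideal v 0 (Y 1 0) & frac_ideal v 0 (Y 1 1)].
Proof.
rewrite /eichler /stab -/Y; split=> [[OY Y01]|[Y00 Y01 Y10 Y11]]; first by split.
split=> //; rewrite (mx2_eta Y); apply/integral_mx2; split=> //.
exact: frac_ideal_le Y01.
Qed.

(** Of the four conditions in [stab_normal_mx], only the upper right one is not automatic:
    [u pi^i (a - d) + b - (u pi^i)^2 c] in [m_K^(i+s)]. There [b] is negligible because
    [s <= D - i], the term in [c] because [s <= i], and [u] is a unit, so [a = d] modulo [pi^s] is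
    left. *)
Lemma eichler_stab_normal g (D : nat) (i : int) (s : nat) u X : g \in unitmx -> unit_elt u ->
  s%:Z <= i -> s%:Z <= D%:Z - i -> eichler g D X ->
  (stab (g *m normal_mx i s u) X <->
   frac_ideal v s%:Z (in_basis g X 0 0 - in_basis g X 1 1)).
Proof.
move=> gu uu si sD /eichlerP [Y00 Y01 Y10 Y11].
rewrite /stab in_basisM ?normal_mx_unit //.
move: Y00 Y01 Y10 Y11; move: (in_basis g X) => Y; rewrite [Y in in_basis _ Y]mx2_eta.
move: (Y 0 0) (Y 0 1) (Y 1 0) (Y 1 1) => a b c d Oa Db Oc Od.
have Ou := unit_elt_integral uu.
have Oui : frac_ideal v i (u * pi ^ i).
  by apply: frac_idealMl => //; apply: frac_ideal_exp.
have Ob : frac_ideal v (i + s%:Z) b by apply: frac_ideal_le Db; lia.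
have Ouc : frac_ideal v (i + s%:Z) ((u * pi ^ i) ^+ 2 * c).
  rewrite mulrC; apply: frac_idealMl => //; rewrite expr2.
  by apply: (@frac_ideal_le _ _ (i + i)); [lia | apply: frac_idealM].
have uE : u * pi ^ i * (a - d) = pi ^ i * (u * (a - d)) by ring.
have -> : integral_mx (in_basis (normal_mx i s u) (mx2 a b c d)) <->
   frac_ideal v (i + s%:Z) (u * pi ^ i * (a - d) + b - (u * pi ^ i) ^+ 2 * c).
  rewrite -/(stab _ _) stab_normal_mx; split=> [[] //|H].
  have Oi : frac_ideal v 0 (u * pi ^ i) by apply: frac_ideal_le Oui; lia.
  split=> //.
  - by apply: frac_idealB => //; apply: frac_idealMl.
  - by apply: frac_ideal_le Oc; lia.
  - by apply: frac_idealD => //; apply: frac_idealMl.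
have -> : frac_ideal v s%:Z (a - d) <->
   frac_ideal v (i + s%:Z) (u * pi ^ i * (a - d)).
  rewrite uE (frac_ideal_expM hpi) addrAC subrr add0r.
  split=> H; first exact: frac_idealMl.
  have -> : a - d = u^-1 * (u * (a - d)) by rewrite mulKf //; case: uu.
  by apply: frac_idealMl => //; apply/unit_elt_integral/unit_eltV.
split=> H; last by apply: frac_idealB => //; apply: frac_idealD.
have -> : u * pi ^ i * (a - d) = u * pi ^ i * (a - d) + b - (u * pi ^ i) ^+ 2 * c
   + (u * pi ^ i) ^+ 2 * c - b by ring.
by apply: frac_idealB => //; apply: frac_idealD.
Qed.

(** Conjugation by [diag(pi^D, 1)] divides the upper right entry by [pi^D] and multiplies the lower
    left one by it. *)
Lemma eichler_pair g (D : nat) X : g \in unitmx ->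
  eichler g D X <-> stab g X /\ stab (g *m mx2 (pi ^ D%:Z) 0 0 1) X.
Proof.
move=> gu; rewrite /eichler; have D0 : pi ^ D%:Z * 1 - 0 * 0 != 0.
  by rewrite mulr1 mulr0 subr0.
have kE : stab (g *m mx2 (pi ^ D%:Z) 0 0 1) X =
    integral_mx (mx2 (in_basis g X 0 0) (pi ^ (- D%:Z) * in_basis g X 0 1)
                     (pi ^ D%:Z * in_basis g X 1 0) (in_basis g X 1 1)).
  rewrite /stab in_basisM //; last by rewrite mx2_unit.
  move: (in_basis g X) => Y; rewrite {1}[Y]mx2_eta in_basis_mx2 // unif_expN //.
  by congr integral_mx; congr mx2; field.
rewrite kE integral_mx2 (propext (frac_ideal_expM hpi (- D%:Z) _ _)) sub0r opprK.
split=> [[sX X01]|[sX []//]]; split=> //; split=> //.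
by apply: frac_idealMl => //; apply: (frac_ideal_le _ (frac_ideal_exp hpi _)).
Qed.

(* In the tree of lattice classes, the vertex of [normal_mx i s u] is at
   distance [s + i] from the vertex [g] when [0 <= i], and at distance
   [s + D - i] from the vertex [g diag(pi^D, 1)] when [i <= D]: the bases below
   are adapted to these paths. *)
Lemma eichler_normal_left g (i s : nat) u X : g \in unitmx -> unit_elt u ->
  stab g X -> stab (g *m normal_mx i s u) X ->
  eichler (g *m mx2 1 (u * pi ^ i%:Z) 0 1) (s + i) X.
Proof.
move=> gu uu sg sn; have O1 := frac_ideal1 v; have O0 := frac_ideal0 v 0.
have Oui : frac_ideal v 0 (u * pi ^ i%:Z).
  apply: frac_idealMl; first exact: unit_elt_integral.
  exact: (frac_ideal_le _ (frac_ideal_exp hpi _)).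
have ku : mx2 1 (u * pi ^ i%:Z) 0 1 \in unitmx.
  by rewrite mx2_unit mulr1 mulr0 subr0 oner_neq0.
apply/eichler_pair; first by rewrite unitmx_mul gu.
split; last first.
  rewrite -mulmxA; set n := _ *m mx2 (pi ^ _) _ _ _.
  suff -> : n = normal_mx i s u by [].
  rewrite /n mul_mx2 /normal_mx PoszD [s%:Z + _]addrC; congr mx2; ring.
rewrite -[_ *m _]scale1r.
apply/(@stab_mulr _ _ _ (mx2 1 (- (u * pi ^ i%:Z)) 0 1)); rewrite ?oner_neq0 //.
- by rewrite mul_mx2 mx2_1; congr mx2; ring.
- exact/integral_mx2.
- by apply/integral_mx2; split=> //; apply: frac_idealN.
Qed.

Lemma eichler_normal_right g (D e s : nat) (i : int) u X :
  g \in unitmx -> unit_elt u -> i + e%:Z = D%:Z ->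
  stab (g *m mx2 (pi ^ D%:Z) 0 0 1) X -> stab (g *m normal_mx i s u) X ->
  eichler (g *m mx2 0 (u * pi ^ D%:Z) 1 (pi ^ e%:Z)) (s + e) X.
Proof.
move=> gu uu ie sD sn; have O1 := frac_ideal1 v; have O0 := frac_ideal0 v 0.
have Ou := unit_elt_integral uu; have OV := unit_elt_integral (unit_eltV uu).
have ON1 := frac_idealN O1; have u0 : u != 0 by case: uu.
have Oe (n : nat) : frac_ideal v 0 (pi ^ n%:Z).
  exact: (frac_ideal_le _ (frac_ideal_exp hpi _)).
have Du : mx2 (pi ^ D%:Z) 0 0 1 \in unitmx.
  by rewrite mx2_unit mulr1 mulr0 subr0.
apply/eichler_pair.
  by rewrite unitmx_mul gu mx2_unit mul0r sub0r mulr1 oppr_eq0 mulf_neq0.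
split.
  have -> : mx2 0 (u * pi ^ D%:Z) 1 (pi ^ e%:Z) =
      1 *: (mx2 (pi ^ D%:Z) 0 0 1 *m mx2 0 u 1 (pi ^ e%:Z)).
    by rewrite scale1r mul_mx2; congr mx2; ring.
  rewrite scale1r mulmxA -[_ *m _]scale1r.
  apply/(@stab_mulr _ _ _ (mx2 (- u^-1 * pi ^ e%:Z) 1 u^-1 0)); rewrite ?oner_neq0 //.
  - by rewrite unitmx_mul gu.
  - by rewrite mul_mx2 mx2_1; congr mx2; field.
  - exact/integral_mx2.
  - apply/integral_mx2; split=> //; apply: frac_idealMl => //; exact: frac_idealN.
rewrite -mulmxA; set n := _ *m mx2 (pi ^ _) _ _ _.
(* The last factor has determinant [- u], a unit, so up to the homothety [pi ^ e] the far end of the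
   path is the given vertex. *)
have -> : n = pi ^ e%:Z *: (normal_mx i s u *m mx2 (- u) 0 (pi ^ s%:Z) 1).
  rewrite /n /normal_mx !mul_mx2 scale_mx2 -ie PoszD !(unif_expD hpi).
  by congr mx2; ring.
rewrite scalemxAr mulmxA -scalemxAr.
apply/(@stab_mulr _ _ _ (mx2 (- u^-1) 0 (u^-1 * pi ^ s%:Z) 1)) => //.
- by rewrite unitmx_mul gu normal_mx_unit.
- by rewrite mul_mx2 mx2_1; congr mx2; field.
- by apply/integral_mx2; split=> //; apply: frac_idealN.
- by apply/integral_mx2; split=> //; [apply: frac_idealN | apply: frac_idealMl].
Qed.

Lemma stab_normal_form_in g h : g \in unitmx -> h \in unitmx ->
  exists i s u,
    unit_elt u /\ forall X, stab h X <-> stab (g *m normal_mx i s u) X.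
Proof.
move=> gu hu; have gh : invmx g *m h \in unitmx by rewrite unitmx_mul unitmx_inv gu.
have [i [s [u [uu H]]]] := stab_normal_form gh.
exists i, s, u; split=> // X; rewrite -{1}[h](mulKVmx gu).
rewrite /stab (in_basisM X gu gh) in_basisM ?normal_mx_unit //; exact: H.
Qed.

(** * Closed orders, classified by a longest fixed path *)

Lemma stab_chain_bound (A : set 'M[K]_2) : order_in_M2 v A ->
  exists N : nat, forall g (D : nat), g \in unitmx ->
    (forall X, A X -> eichler g D X) -> (D <= N)%N.
Proof.
move=> [/free_submodule4_commutator [X [Y [AX AY XY0]]] _ _].
(* One commutator with nonzero determinant, chosen before [g], bounds all lengths by the valuation
   of that determinant. *)
exists `|v (\det (X *m Y - Y *m X))|%N => g D gu HA.
have [/eqP|] := eichler_commutator gu (HA X AX) (HA Y AY).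
  by rewrite (negbTE XY0).
by lia.
Qed.

Definition bolytrope_mx g (r m : nat) X (Y := in_basis g X) : Prop :=
  [/\ integral_mx Y, frac_ideal v (m + r)%N%:Z (Y 0 1),
      frac_ideal v r%:Z (Y 1 0) & frac_ideal v r%:Z (Y 0 0 - Y 1 1)].

(** Moving the base vertex [r] steps along the path of length [m + 2r] shifts a factor [pi^r] from
    the upper right to the lower left entry and keeps the diagonal; the exponents become [m + r] and
    [r]. *)
Lemma eichler_bolytrope_mx g (r m : nat) X : g \in unitmx ->
  eichler g (m + r.*2) X /\
    frac_ideal v r%:Z (in_basis g X 0 0 - in_basis g X 1 1) <->
  bolytrope_mx (g *m mx2 (pi ^ r%:Z) 0 0 1) r m X.
Proof.
move=> gu; have r0 : pi ^ r%:Z * 1 - 0 * 0 != 0 by rewrite mulr1 mulr0 subr0.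
rewrite eichlerP /bolytrope_mx in_basisM //; last by rewrite mx2_unit.
move: (in_basis g X) => Y; rewrite [Y in in_basis _ Y]mx2_eta.
move: (Y 0 0) (Y 0 1) (Y 1 0) (Y 1 1) => a b c d.
rewrite in_basis_mx2 //.
set Z := mx2 _ _ _ _; have -> : Z = mx2 a (pi ^ (- r%:Z) * b) (pi ^ r%:Z * c) d.
  by rewrite /Z unif_expN //; congr mx2; field.
rewrite (propext (integral_mx2 _ _ _ _)) !mxE /= !(propext (frac_ideal_expM hpi _ _ _)) subrr.
rewrite !opprK sub0r add0r.
have -> : (m + r)%N%:Z + r%:Z = (m + r.*2)%N%:Z by lia.
split=> [[[Oa Db Oc Od] rad]|[[Oa _ _ Od] Db Oc rad]]; split=> //; split=> //.
  by apply: frac_ideal_le Db; lia.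
by apply: frac_ideal_le Oc; lia.
Qed.

Lemma closed_order_bolytrope_mx (A : set 'M[K]_2) : closed_order v pi A ->
  exists (r m : nat) g, g \in unitmx /\ forall X, A X <-> bolytrope_mx g r m X.
Proof.
move=> Acl; have Aord := Acl.1; have [Afree _ _] := Aord.
(* Without a fixed vertex the condition of [closed_order_stab] would hold vacuously, and [A] would
   be the whole algebra. *)
have [h0 [h0u Ah0]] : exists h, h \in unitmx /\ forall X, A X -> stab h X.
  apply: contrapT => /forallNP noh; have [X] := free_submodule4_proper Afree.
  by apply; apply: closed_order_stab => // h hu Ah; case: (noh h).
pose P D := `[< exists g, g \in unitmx /\ forall X, A X -> eichler g D X >].
have exP : exists D, P D.
  exists 0%N; apply/asboolP; exists h0; split=> // X AX; split; first exact: Ah0.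
  exact: Ah0.
have [N PN] := stab_chain_bound Aord.
have ubP D : P D -> (D <= N)%N by move=> /asboolP [g [gu /PN]]; apply.
have [D /asboolP [g [gu AD]] Dmax] := ex_maxnP exP ubP.
have maxD g' D' : g' \in unitmx -> (forall X, A X -> eichler g' D' X) -> (D' <= D)%N.
  by move=> gu' H; apply/Dmax/asboolP; exists g'.
(* The paths from the two ends of the diameter to the fixed vertex have lengths [s + i] and
   [s + D - i] when the branch point is between the ends; by maximality neither exceeds [D]. *)
have shape i s u : unit_elt u ->
    (forall X, A X -> stab (g *m normal_mx i s u) X) ->
    s%:Z <= i /\ s%:Z <= D%:Z - i.
  move=> uu As; have left (j : nat) : i = j -> (s + j <= D)%N.
    move=> ij; apply: (maxD (g *m mx2 1 (u * pi ^ j%:Z) 0 1)).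
      by rewrite unitmx_mul gu mx2_unit mulr1 mulr0 subr0 oner_neq0.
    move=> X AX; apply: eichler_normal_left => //; first by case: (AD X AX).
    by rewrite -ij; apply: As.
  have right (e : nat) : i + e%:Z = D%:Z -> (s + e <= D)%N.
    move=> ie; apply: (maxD (g *m mx2 0 (u * pi ^ D%:Z) 1 (pi ^ e%:Z))).
      rewrite unitmx_mul gu mx2_unit mul0r sub0r mulr1 oppr_eq0 mulf_neq0 //.
      by case: uu.
    move=> X AX; apply: eichler_normal_right ie _ _ => //; last exact: As.
    by have [] := (eichler_pair D X gu).1 (AD X AX).
  (* A branch point beyond one end, [i < 0] or [D < i], contradicts the bound on the path from the
     other end. *)
  case: (ltP i 0) => [i0|i0].
    have := right `|D%:Z - i|%N; lia.
  have := left `|i|%N; case: (leP i D%:Z) => iD; last by lia.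
  have := right `|D%:Z - i|%N; lia.
(* The bound [r.*2 <= D] makes [m = D - 2r] a natural number; by [shape], every [s] coming from a
   fixed vertex satisfies it. *)
pose Q (r : nat) := `[< (r.*2 <= D)%N /\ forall X, A X ->
  frac_ideal v r%:Z (in_basis g X 0 0 - in_basis g X 1 1) >].
have exQ : exists r, Q r.
  exists 0%N; apply/asboolP; split=> // X AX; have [OX _] := AD X AX.
  by apply: frac_idealB; apply: OX.
have ubQ r : Q r -> (r <= D)%N by move=> /asboolP [? _]; lia.
have [r /asboolP [rD Ar] rmax] := ex_maxnP exQ ubQ.
exists r, (D - r.*2)%N, (g *m mx2 (pi ^ r%:Z) 0 0 1); split.
  by rewrite unitmx_mul gu mx2_unit mulr1 mulr0 subr0 pi0.
move=> X; rewrite -eichler_bolytrope_mx // subnK //.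
split=> [AX|[XD Xr]]; first by split; [apply: AD | apply: Ar].
apply: closed_order_stab => // h hu Ah.
have [i [s [u [uu hE]]]] := stab_normal_form_in gu hu.
have As Y : A Y -> stab (g *m normal_mx i s u) Y by move=> /Ah /hE.
have [si sDi] := shape i s u uu As.
apply/hE/(eichler_stab_normal gu uu si sDi XD).
(* All of [A] satisfies the congruence modulo [pi^s], so [s] competes with [r] in the choice of the
   maximum. *)
suff /frac_ideal_le : (s%:Z <= r%:Z) by apply.
rewrite lez_nat; apply/rmax/asboolP; split=> [|Y AY]; first by lia.
exact/(eichler_stab_normal gu uu si sDi (AD Y AY))/As.
Qed.

(** * Bolytrope orders *)

Lemma graduated_orderE g (m : nat) :
  graduated_order v pi g (upper_exponent m) = [set X | eichler g m X].
Proof.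
apply/seteqP; split=> X /=.
  move=> H; apply/eichlerP.
  by split; [have := H 0 0 | have := H 0 1 | have := H 1 0 | have := H 1 1];
    rewrite [upper_exponent _ _ _]mxE (max_ideal_powE hpi).
move=> /eichlerP [X00 X01 X10 X11] i j; rewrite (max_ideal_powE hpi) [upper_exponent _ _ _]mxE.
by case: (ord2P i) => ->; case: (ord2P j) => ->.
Qed.

Lemma eichler1 g (D : nat) : g \in unitmx -> eichler g D 1%:M.
Proof.
move=> gu; apply/eichlerP; rewrite /in_basis mulmx1 mulVmx // !mxE /=.
by split; [exact: frac_ideal1 | exact: frac_ideal0 | exact: frac_ideal0 |
  exact: frac_ideal1].
Qed.

(** The identity in [A] gives that [L] is contained in [A L]; the other inclusion is stability. *)
Lemma Qset_lat (A : set 'M[K]_2) h : h \in unitmx -> A 1%:M ->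
  (forall Y, A Y -> stab h Y) -> Qset v pi A (homothety_class pi (lat h)).
Proof.
move=> hu A1 Ah; exists (lat h) => //; split; first exact: lattice_lat.
apply/seteqP; split=> x.
  move=> [n [Y [y [AL ->]]]]; apply: big_ind => [|a b|i _].
  - exists 0; last by rewrite mulmx0.
    by move=> i j; rewrite mxE; apply: frac_ideal0.
  - exact: latD.
  - by have [/Ah /lattice_end_lat H Ly] := AL i; apply: H.
move=> Lx; exists 1%N, (fun=> 1%:M), (fun=> x); split=> //.
by rewrite big_ord1 mul1mx.
Qed.

(** Integrality of [pi^r k] and of [k'] gives the chain [pi^r L1 <= L2 <= L1] for
    [L1 = lat (g0 *m k)] and [L2 = lat g0], where [L2] is stable under the graduated order. *)
Lemma bolytrope_lat g g0 k k' (r m : nat) : g \in unitmx -> g0 \in unitmx ->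
  (forall Y, eichler g m Y -> stab g0 Y) ->
  k *m k' = 1%:M -> integral_mx k' -> integral_mx (pi ^ r%:Z *: k) ->
  bolytrope v pi g r (upper_exponent m) (homothety_class pi (lat (g0 *m k))).
Proof.
move=> gu g0u Hg0 kk' Ok' Ork; have ku := (mulmx1_unit kk').1.
split; first by exists (lat (g0 *m k)) => //; apply: lattice_lat; rewrite unitmx_mul g0u.
exists (homothety_class pi (lat g0)).
(* [is_dist] asks for the exact distance, which is the least [t] with [P t]. *)
pose P t := `[< within_dist pi (homothety_class pi (lat (g0 *m k)))
                              (homothety_class pi (lat g0)) t >].
have Pr : P r.
  apply/asboolP; exists (lat (g0 *m k)), (lat g0).
  split; [exact: homothety_class_refl | exact: homothety_class_refl | |].
    move=> _ [_ [y Oy <-] <-]; exists (pi ^ r%:Z *: k *m y).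
      exact: integral_mxM.
    by rewrite -!scalemxAl -scalemxAr mulmxA.
  move=> _ [y Oy <-]; exists (k' *m y); first exact: integral_mxM.
  by rewrite !mulmxA -(mulmxA g0) kk' mulmx1.
have exP : exists t, P t by exists r.
have [s /asboolP Ps smin] := ex_minnP exP.
exists s; split; last exact: smin.
- rewrite graduated_orderE; apply: Qset_lat => //; exact: eichler1.
- by split=> // t /asboolP; apply: smin.
Qed.

Lemma bolytrope_order_stab g g0 k k' (r m : nat) X :
  g \in unitmx -> g0 \in unitmx -> (forall Y, eichler g m Y -> stab g0 Y) ->
  k *m k' = 1%:M -> integral_mx k' -> integral_mx (pi ^ r%:Z *: k) ->
  bolytrope_order v pi g r (upper_exponent m) X -> stab (g0 *m k) X.
Proof.
move=> gu g0u Hg0 kk' Ok' Ork HX.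
have hu : g0 *m k \in unitmx by rewrite unitmx_mul g0u (mulmx1_unit kk').1.
apply/lattice_end_lat => //; apply: HX; split; first exact: lattice_lat.
exact: bolytrope_lat kk' _ _.
Qed.

(** Write [X = a + pi^r T] with [T] in the graduated order. Up to homothety, [pi^r] maps [L] into a
    stable lattice [L'], [T] preserves [L'], and [L'] lies in [L]; hence [pi^r T] preserves [L]. *)
Lemma bolytrope_mx_end g (r m : nat) X L : g \in unitmx ->
  bolytrope_mx g r m X -> lattice v L ->
  bolytrope v pi g r (upper_exponent m) (homothety_class pi L) ->
  lattice_end L X.
Proof.
move=> gu [OX X01 X10 Xd] latL [_ [c' [s [[L' [latL' actL'] <-] [[L1 [L2]]]]]]].
move=> [[n _ <-] [n' _ <-] sub12 sub21] _ sr.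
have [h hu Lh] := lattice_is_lat latL; have [h' hu' Lh'] := lattice_is_lat latL'.
set a := in_basis g X 1 1.
pose Z := mx2 (pi ^ (- r%:Z) * (in_basis g X 0 0 - a))
  (pi ^ (- r%:Z) * in_basis g X 0 1) (pi ^ (- r%:Z) * in_basis g X 1 0) 0.
pose T := in_basis (invmx g) Z.
have ZE : in_basis g T = Z by rewrite /T in_basis_invK.
have LT : eichler g m T.
  apply/eichlerP; rewrite ZE !mx2E; split; last exact: frac_ideal0.
  - by apply/(frac_ideal_expM hpi); rewrite sub0r opprK.
  - by apply/(frac_ideal_expM hpi); apply: frac_ideal_le X01; lia.
  - by apply/(frac_ideal_expM hpi); rewrite sub0r opprK.
have XE : X = a%:M + pi ^ r%:Z *: T.
  have Xg : in_basis g X = a%:M + pi ^ r%:Z *: Z.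
    rewrite /Z /a; move: (in_basis g X) => Y; rewrite [LHS]mx2_eta.
    move: (Y 0 0) (Y 0 1) (Y 1 0) (Y 1 1) => e b c d.
    rewrite scale_mx2 !mulrA -!(unif_expD hpi) subrr expr0z !mul1r.
    apply/matrixP => i j; rewrite !mxE.
    by case: (ord2P i) => ->; case: (ord2P j) => -> /=;
      rewrite ?mulr1n ?mulr0n ?mulr0 ?add0r ?addr0 // addrC subrK.
  rewrite -[LHS](in_basis_invK _ (g := invmx g)) ?unitmx_inv // invmxK Xg.
  rewrite /T /in_basis invmxK mulmxDr mulmxDl -!scalemxAr -!scalemxAl.
  by rewrite mul_mx_scalar -scalemxAl mulmxV // scalemx1.
move=> x Lx; rewrite XE mulmxDl mul_scalar_mx -scalemxAl scalemxAr.
rewrite Lh in Lx *; apply: latD; first by apply: latZ => //; apply: OX.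
have L'w : L' ((pi ^ n')^-1 *: (pi ^ r%:Z *: (pi ^ n *: x))).
  have : scale_set (pi ^ n') L' (pi ^+ s *: (pi ^ n *: x)).
    by apply: sub12; exists (pi ^ n *: x) => //; exists x; rewrite ?Lh.
  rewrite scale_setE // Lh' => L'x.
  (* The distance [s] may be smaller than [r]; the surplus [pi^(r - s)] is integral. *)
  have -> : r%:Z = (r - s)%N%:Z + s%:Z by lia.
  rewrite (unif_expD hpi) scalerA mulrCA -scalerA -[X in lat _ (_ *: X)]scalerA.
  apply: latZ => //; exact: (frac_ideal_le _ (frac_ideal_exp hpi _)).
have L'Tw : L' (T *m ((pi ^ n')^-1 *: (pi ^ r%:Z *: (pi ^ n *: x)))).
  rewrite -[in X in X _]actL'; exists 1%N, (fun=> T); eexists (fun=> _).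
  by split=> [|]; [rewrite graduated_orderE; split; last exact: L'w | rewrite big_ord1].
have := sub21 _ (ex_intro2 _ _ _ L'Tw erefl); rewrite scale_setE // -Lh.
rewrite -!scalemxAr !scalerA; congr (L (_ *: _)).
by field; rewrite !pi0.
Qed.

Lemma bolytrope_orderE g (r m : nat) : g \in unitmx ->
  bolytrope_order v pi g r (upper_exponent m) = [set X | bolytrope_mx g r m X].
Proof.
move=> gu; have O1 := frac_ideal1 v; have O0 := frac_ideal0 v 0.
have ON1 := frac_idealN O1.
have Oe (n : nat) : frac_ideal v 0 (pi ^ n%:Z).
  exact: (frac_ideal_le _ (frac_ideal_exp hpi _)).
have rN : pi ^ r%:Z * pi ^ (- r%:Z) = 1 by rewrite -(unif_expD hpi) subrr expr0z.
have stab_g Y : eichler g m Y -> stab g Y by case.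
have stab_gm Y : eichler g m Y -> stab (g *m mx2 (pi ^ m%:Z) 0 0 1) Y.
  by move=> /(eichler_pair _ _ gu) [].
apply/seteqP; split=> X /=; last first.
  by move=> HX L [latL BL]; apply: bolytrope_mx_end HX _ BL.
move=> HX.
have r0 := pi0 r%:Z; have m0 := pi0 m%:Z.
have k1 : mx2 (pi ^ (- r%:Z)) 0 0 1 *m mx2 (pi ^ r%:Z) 0 0 1 = 1%:M.
  by rewrite mul_mx2 mx2_1 unif_expN //; congr mx2; field.
have k2 : mx2 1 0 0 (pi ^ (- r%:Z)) *m mx2 1 0 0 (pi ^ r%:Z) = 1%:M.
  by rewrite mul_mx2 mx2_1 unif_expN //; congr mx2; field.
have k3 : mx2 1 (pi ^ (- r%:Z)) 0 (pi ^ (- r%:Z)) *m mx2 1 (- 1) 0 (pi ^ r%:Z) =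
    1%:M.
  by rewrite mul_mx2 mx2_1 unif_expN //; congr mx2; field.
have gmu : g *m mx2 (pi ^ m%:Z) 0 0 1 \in unitmx.
  by rewrite unitmx_mul gu mx2_unit mulr1 mulr0 subr0 m0.
have Ymx := mx2_eta (in_basis g X).
(* This vertex lies on the apartment, [r] steps beyond the end [g] of the stable path; it forces the
   lower left entry into [m_K^r]. *)
have S1 : stab (g *m mx2 (pi ^ (- r%:Z)) 0 0 1) X.
  apply: bolytrope_order_stab stab_g k1 _ _ HX => //; first exact/integral_mx2.
  by rewrite scale_mx2 rN !mulr0 mulr1; apply/integral_mx2.
(* Likewise [r] steps beyond the other end; it forces the upper right entry into [m_K^(m+r)]. *)
have S2 : stab (g *m mx2 (pi ^ m%:Z) 0 0 (pi ^ (- r%:Z))) X.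
  have -> : mx2 (pi ^ m%:Z) 0 0 (pi ^ (- r%:Z)) =
      mx2 (pi ^ m%:Z) 0 0 1 *m mx2 1 0 0 (pi ^ (- r%:Z)).
    by rewrite mul_mx2; congr mx2; ring.
  rewrite mulmxA; apply: bolytrope_order_stab stab_gm k2 _ _ HX => //.
    exact/integral_mx2.
  by rewrite scale_mx2 rN !mulr0 mulr1; apply/integral_mx2.
(* From [g], [r] steps in the direction of [e1 + e2], off the apartment: this forces [a - d + b - c]
   into [m_K^r], and the first two vertices remove [b] and [c]. *)
have S3 : stab (g *m mx2 1 (pi ^ (- r%:Z)) 0 (pi ^ (- r%:Z))) X.
  apply: bolytrope_order_stab stab_g k3 _ _ HX => //; first exact/integral_mx2.
  by rewrite scale_mx2 rN !mulr0 mulr1; apply/integral_mx2.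
move: S1 S2 S3; have rN0 := pi0 (- r%:Z); rewrite /bolytrope_mx /stab.
rewrite !in_basisM // ?mx2_unit ?mulr0 ?mul0r ?subr0 ?mulr1 ?mul1r ?mulf_neq0 //.
move: (in_basis g X) Ymx => Y ->; move: (Y 0 0) (Y 0 1) (Y 1 0) (Y 1 1) => a b c d.
have -> : in_basis (mx2 (pi ^ (- r%:Z)) 0 0 1) (mx2 a b c d) =
    mx2 a (pi ^ r%:Z * b) (pi ^ (- r%:Z) * c) d.
  rewrite in_basis_mx2 ?mulr0 ?subr0 ?mulr1 // unif_expN //.
  by congr mx2; field; rewrite ?r0 ?m0 ?oner_neq0.
have -> : in_basis (mx2 (pi ^ m%:Z) 0 0 (pi ^ (- r%:Z))) (mx2 a b c d) =
    mx2 a (pi ^ (- (m + r)%N%:Z) * b) (pi ^ (m + r)%N%:Z * c) d.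
  rewrite in_basis_mx2 ?mulr0 ?subr0 ?mulf_neq0 // !unif_expN // PoszD (unif_expD hpi).
  by congr mx2; field; rewrite ?r0 ?m0 ?oner_neq0.
have -> : in_basis (mx2 1 (pi ^ (- r%:Z)) 0 (pi ^ (- r%:Z))) (mx2 a b c d) =
    mx2 (a - c) (pi ^ (- r%:Z) * (a - d + b - c)) (pi ^ r%:Z * c) (c + d).
  rewrite in_basis_mx2 ?mulr0 ?subr0 ?mul1r // unif_expN //.
  by congr mx2; field; rewrite ?r0 ?m0 ?oner_neq0.
rewrite !(propext (integral_mx2 _ _ _ _)) !mx2E.
rewrite !(propext (frac_ideal_expM hpi _ _ _)) !sub0r !opprK.
move=> [Oa _ Oc Od] [_ Ob _ _] [_ Oabcd _ _].
have Ob' : frac_ideal v r%:Z b by apply: frac_ideal_le Ob; lia.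
split=> //; last first.
  have -> : a - d = a - d + b - c + c - b by ring.
  by apply: frac_idealB => //; apply: frac_idealD.
split=> //; first exact: frac_ideal_le Ob'.
exact: frac_ideal_le Oc.
Qed.

End Stabilizers.

Theorem theorem7p1 (K : fieldType) (v : discrete_valuation K) (pi : K)
    (hpi : uniformizer v pi) (A : set 'M[K]_2) (hA : closed_order v pi A) :
  exists (r m : nat) (g : 'M[K]_2),
    [/\ g \in unitmx,
        A = bolytrope_order v pi g r (upper_exponent m) &
        bolytrope_order v pi g r (upper_exponent m) =
          [set X : 'M[K]_2 |
             [/\ forall i j, valuation_ring v (in_basis g X i j),
                 max_ideal_pow v pi (m + r)%N%:Z (in_basis g X 0 1),
                 max_ideal_pow v pi r%:Z (in_basis g X 1 0) &
                 max_ideal_pow v pi r%:Z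
                   (in_basis g X 0 0 - in_basis g X 1 1)]]].
Proof.
have [r [m [g [gu AE]]]] := closed_order_bolytrope_mx hpi hA.
have BE := bolytrope_orderE hpi r m gu.
exists r, m, g; split=> //; first by rewrite BE; apply/seteqP; split=> X /AE.
by rewrite BE !(max_ideal_powE hpi).
Qed.
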